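(* Let $b>1$ be real. Then $$\pi=\frac{8b^4}{1+b^2}\;\frac{(b^6-1)\,K\!\left(\dfrac{2b}{1+b^2}\right)+(1-b^2)(1+b^2)^2\,E\!\left(\dfrac{2b}{1+b^2}\right)}{4b^6+3(1-b^2)\,F_1\!\left(\tfrac52;1,\tfrac12;3\,\Big|\,\dfrac1{b^2},\dfrac1{b^4}\right)}.$$
   Context: $K(k)=\int_0^1\frac{dx}{\sqrt{(1-x^2)(1-k^2x^2)}}$ and $E(k)=\int_0^1\sqrt{\frac{1-k^2x^2}{1-x^2}}\,dx$ are the complete elliptic integrals of the first and second kind, as functions of the modulus $k$. The two-variable Appell function is $F_1(\alpha;\beta_1,\beta_2;\gamma\,|\,x,y)=\sum_{m,n\ge0}\frac{(\alpha)_{m+n}(\beta_1)_m(\beta_2)_n}{(\gamma)_{m+n}\,m!\,n!}x^my^n$ for $|x|,|y|<1$, with $(x)_k$ the Pochhammer symbol. For $\operatorname{Re}\gamma>\operatorname{Re}\alpha>0$ it equals, and outside the region of convergence is defined by analytic continuation through, $\frac{\Gamma(\gamma)}{\Gamma(\alpha)\Gamma(\gamma-\alpha)}\int_0^1\frac{u^{\alpha-1}(1-u)^{\gamma-\alpha-1}}{(1-xu)^{\beta_1}(1-yu)^{\beta_2}}\,du$ (principal branches, $x,y\notin[1,\infty)$). *)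

(* Defs.v *)
From Stdlib Require Import Reals Factorial.
From Coquelicot Require Import Coquelicot.
Open Scope R_scope.

(* Complete elliptic integrals as functions of the modulus k (not of the
   parameter k^2). The integrands are unbounded at x = 1, so both integrals
   are improper Riemann integrals there. *)
Definition ellipticK (k : R) : R :=
  RInt_gen (fun x => 1 / sqrt ((1 - x ^ 2) * (1 - k ^ 2 * x ^ 2)))
           (at_point 0) (at_left 1).

Definition ellipticE (k : R) : R :=
  RInt_gen (fun x => sqrt ((1 - k ^ 2 * x ^ 2) / (1 - x ^ 2)))
           (at_point 0) (at_left 1).

(* (a)_n = a (a+1) ... (a+n-1) *)
Fixpoint pochhammer (a : R) (n : nat) : R :=
  match n with
  | O => 1
  | S p => pochhammer a p * (a + INR p)
  end.

Definition appellF1_term (alpha beta1 beta2 gamma x y : R) (m n : nat) : R :=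
  pochhammer alpha (m + n) * pochhammer beta1 m * pochhammer beta2 n
  / (pochhammer gamma (m + n) * INR (fact m) * INR (fact n))
  * x ^ m * y ^ n.

(* F_1(alpha; beta1, beta2; gamma | x, y) for |x|, |y| < 1 and gamma not in
   {0, -1, -2, ...}. The double series converges absolutely there, so the
   iterated sum is its sum. The analytic continuation outside this region is
   not covered. *)
Definition appellF1 (alpha beta1 beta2 gamma x y : R) : R :=
  Series (fun m => Series (fun n =>
    appellF1_term alpha beta1 beta2 gamma x y m n)).

(* Main.v *)
Require Import Defs.
From Stdlib Require Import Reals Lra Lia Ranalysis5 Factorial.
From Coquelicot Require Import Coquelicot.
Open Scope R_scope.

(** Put t = 1/b^2 and D(x) = sqrt (1 - t^2 sin^2 x). All three transcendental
    quantities become integrals over [0, pi/2] with the same radical D.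

    - The modulus k = 2b/(1+b^2) is 2 sqrt t / (1+t), so that Gauss's form of
      the Landen transformation, y = (1+t) sin x / (1 + t sin^2 x), turns K(k)
      into (1+t) times the integral of 1/D, and (1+t) E(k) into the integral of
      2D - (1-t^2)/D, up to an exact derivative ([ellipticK_gauss],
      [ellipticE_gauss]). The combination in the numerator is then an explicit
      multiple of V, the integral of (1 + 2t sin^2 x)/D
      ([numerator_integral_gauss]).

    - Expanding 1/(1 - t sin^2 x) and 1/D in powers of t, and integrating
      sin^(4+2(m+n)) by Wallis's recurrence, gives
      F_1(5/2; 1, 1/2; 3 | t, t^2) = 16/(3 pi) J, where J is the integral of
      sin^4 x / ((1 - t sin^2 x) D) ([appellF1_integral]).

    - J involves the complete integral of the third kind Pi(n, k) at n = k = t.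
      There it degenerates: (1 + t sin^2 x)/((1 - t sin^2 x) D) is the derivative
      of an elementary arctangent, with integral pi/(2(1-t))
      ([third_kind_integral]). This is where pi enters, as the relation
      4 t^2 J + 2 V = pi/(1-t) ([appell_numerator_relation]).

    By this relation the denominator of the formula is also a multiple of V, so
    the quotient is elementary. It is legitimate because V has a positive
    integrand, even though K and E enter the numerator with opposite signs. *)

(** * Substitution in improper integrals and term-by-term integration *)

(** The integrand f may blow up at h b: only the transformed integrand g has to
    be continuous up to the endpoint. *)
Lemma is_RInt_gen_substitution (f g h h' : R -> R) (a b : R) :
  a < b ->
  (forall x, a <= x <= b -> is_derive h x (h' x) /\ continuous h' x) ->
  (forall x, a < x < b -> 0 < h' x) ->
  (forall y, h a <= y < h b -> continuous f y) ->
  (forall x, a <= x <= b -> continuous g x) ->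
  (forall x, a <= x < b -> h' x * f (h x) = g x) ->
  is_RInt_gen f (at_point (h a)) (at_left (h b)) (RInt g a b).
Proof.
  intros Hab Hh Hpos Hf Hg Hfg.
  assert (Hincr : forall x y, a <= x -> x < y -> y <= b -> h x < h y).
  { intros x y Hx Hxy Hy.
    destruct (MVT_cor2 h h' x y Hxy) as [z [Hz Hzxy]].
    - intros z Hz. apply is_derive_Reals, Hh. lra.
    - assert (0 < h' z * (y - x)) by (apply Rmult_lt_0_compat; [apply Hpos|]; lra).
      lra. }
  assert (Hleft : forall x, a < x < b -> is_RInt f (h a) (h x) (RInt g a x)).
  { intros x Hx.
    assert (Hrange : forall z, a <= z <= x -> h a <= h z < h b).
    { intros z Hz. split; [|apply Hincr; lra].
      destruct (Req_dec a z) as [->|]; [lra|]. apply Rlt_le, Hincr; lra. }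
    assert (Hex : ex_RInt f (h a) (h x)).
    { apply (@ex_RInt_continuous R_CompleteNormedModule). intros y Hy. apply Hf.
      pose proof (Hrange x ltac:(lra)).
      rewrite Rmin_left, Rmax_right in Hy by lra. lra. }
    replace (RInt g a x) with (RInt f (h a) (h x));
      [now apply (@RInt_correct R_CompleteNormedModule)|].
    symmetry. apply is_RInt_unique.
    apply (is_RInt_ext (fun z => scal (h' z) (f (h z)))).
    - rewrite Rmin_left, Rmax_right by lra. intros z Hz. apply Hfg. lra.
    - apply (is_RInt_comp (V := R_CompleteNormedModule));
        rewrite Rmin_left, Rmax_right by lra; intros z Hz.
      + apply Hf, Hrange, Hz.
      + apply Hh. lra. }
  intros P [e HP].
  destruct (Hg b ltac:(lra) (ball (g b) 1)) as [d Hd].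
  { apply locally_ball with (eps := mkposreal 1 Rlt_0_1). }
  set (M := Rabs (g b) + 1).
  assert (HM : 0 < M) by (pose proof (Rabs_pos (g b)); unfold M; lra).
  assert (He : 0 < e / (2 * M)).
  { apply Rdiv_lt_0_compat; [apply cond_pos|lra]. }
  (* Near b the function |g| is at most M, so that the integral of g from any
     point of [x0, b] to b is below e. *)
  set (x0 := Rmax (Rmax ((a + b) / 2) (b - d / 2)) (b - e / (2 * M))).
  assert (Hx0 : (a + b) / 2 <= x0 /\ b - d / 2 <= x0 /\ b - e / (2 * M) <= x0 /\ x0 < b).
  { pose proof (cond_pos d). unfold x0.
    repeat split.
    - eapply Rle_trans; [|apply Rmax_l]. apply Rmax_l.
    - eapply Rle_trans; [|apply Rmax_l]. apply Rmax_r.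
    - apply Rmax_r.
    - repeat apply Rmax_lub_lt; lra. }
  assert (Hx0b : h x0 < h b) by (apply Hincr; lra).
  apply (Filter_prod _ _ _ (fun u => u = h a) (fun y => h x0 < y < h b)).
  - reflexivity.
  - exists (mkposreal _ (proj1 (Rminus_lt_0 _ _) Hx0b)).
    intros y Hy Hyb. simpl in Hy. apply Rabs_lt_between' in Hy. simpl in Hy. lra.
  - intros u y -> Hy. simpl.
    destruct (IVT_interv (fun z => h z - y) x0 b) as [x [Hx Hhx]]; try lra.
    { intros z Hz. apply continuity_pt_minus; [|apply continuity_pt_const; easy].
      apply derivable_continuous_pt. exists (h' z). apply is_derive_Reals, Hh. lra. }
    assert (Hxb : x < b) by (destruct (Req_dec x b) as [->|]; lra).
    replace y with (h x) by lra.
    exists (RInt g a x). split; [apply Hleft; lra|].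
    apply HP.
    assert (Hex : forall u v, a <= u -> u <= v -> v <= b -> ex_RInt g u v).
    { intros u v Hu Huv Hv. apply (@ex_RInt_continuous R_CompleteNormedModule).
      rewrite Rmin_left, Rmax_right by lra. intros z Hz. apply Hg. lra. }
    rewrite <- (RInt_Chasles g a x b) by (apply Hex; lra).
    assert (Htail : Rabs (RInt g x b) <= (b - x) * M).
    { apply abs_RInt_le_const; [lra|apply Hex; lra|].
      intros z Hz.
      assert (Hball : ball (g b) 1 (g z)).
      { apply Hd. change (Rabs (z - b) < d). rewrite Rabs_left1; pose proof (cond_pos d); lra. }
      change (Rabs (g z - g b) < 1) in Hball.
      pose proof (Rabs_triang (g z - g b) (g b)).
      replace (g z - g b + g b) with (g z) in * by ring. unfold M. lra. }
    change (Rabs (RInt g a x - (RInt g a x + RInt g x b)) < e).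
    replace (RInt g a x - (RInt g a x + RInt g x b)) with (- RInt g x b) by ring.
    rewrite Rabs_Ropp.
    apply Rle_lt_trans with (1 := Htail).
    apply Rle_lt_trans with (e / (2 * M) * M).
    + apply Rmult_le_compat_r; lra.
    + replace (e / (2 * M) * M) with (e / 2) by (field; lra).
      pose proof (cond_pos e). lra.
Qed.

(** Term-by-term integration under the Weierstrass M-test: the remainder of the
    series of functions is bounded uniformly by that of the series of M. *)
Lemma is_series_RInt_Weierstrass (f : nat -> R -> R) (F : R -> R) (M : nat -> R) (a b : R) :
  a <= b ->
  (forall n, ex_RInt (f n) a b) ->
  ex_RInt F a b ->
  (forall n x, a <= x <= b -> Rabs (f n x) <= M n) ->
  ex_series M ->
  (forall x, a <= x <= b -> is_series (fun n => f n x) (F x)) ->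
  is_series (fun n => RInt (f n) a b) (RInt F a b).
Proof.
  intros Hab Hf HF HM HsM Hlim.
  assert (Hsum : forall n, is_RInt (fun x => sum_n (fun k => f k x) n) a b
                             (sum_n (fun k => RInt (f k) a b) n)).
  { induction n as [|n IH].
    - rewrite sum_O. apply (is_RInt_ext (f O)).
      + intros. now rewrite sum_O.
      + now apply (@RInt_correct R_CompleteNormedModule).
    - rewrite sum_Sn.
      apply (is_RInt_ext (fun x => plus (sum_n (fun k => f k x) n) (f (S n) x))).
      + intros. now rewrite sum_Sn.
      + apply (is_RInt_plus (V := R_NormedModule)); [exact IH|].
        now apply (@RInt_correct R_CompleteNormedModule). }
  assert (Htail : forall n x, a <= x <= b ->
            Rabs (sum_n (fun k => f k x) n - F x) <= Series M - sum_n M n).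
  { intros n x Hx.
    assert (HsF : ex_series (fun k => f k x)) by (exists (F x); now apply Hlim).
    assert (Habs : ex_series (fun k => Rabs (f (S n + k)%nat x))).
    { apply (@ex_series_le _ R_CompleteNormedModule) with (fun k => M (S n + k)%nat).
      - intros k. change (Rabs (Rabs (f (S n + k)%nat x)) <= M (S n + k)%nat).
        rewrite Rabs_Rabsolu. now apply HM.
      - now apply (ex_series_incr_n M). }
    rewrite <- (is_series_unique _ _ (Hlim x Hx)).
    rewrite (Series_incr_n (fun k => f k x) (S n)), (Series_incr_n M (S n)) by (lia || easy).
    simpl pred. rewrite !sum_n_Reals.
    match goal with |- Rabs (?s - (?s + ?r)) <= ?m - _ =>
      replace (s - (s + r)) with (- r) by ring end.
    rewrite Rabs_Ropp.
    eapply Rle_trans; [now apply Series_Rabs|].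
    match goal with |- _ <= ?s + ?r - ?s => replace (s + r - s) with r by ring end.
    apply Series_le.
    - intros k. split; [apply Rabs_pos|now apply HM].
    - now apply (ex_series_incr_n M). }
  apply (is_lim_seq_spec _ (RInt F a b)). intros e.
  assert (He : 0 < e / (b - a + 1)) by (apply Rdiv_lt_0_compat; [apply cond_pos|lra]).
  pose proof (Series_correct M HsM) as HMlim.
  apply (is_lim_seq_spec _ (Series M)) in HMlim.
  destruct (HMlim (mkposreal _ He)) as [N HN]. exists N. intros n Hn.
  specialize (HN n Hn). simpl in HN. apply Rabs_lt_between in HN.
  assert (HN' : - (e / (b - a + 1)) < sum_n M n - Series M) by exact (proj1 HN).
  change (Rabs (minus (sum_n (fun k => RInt (f k) a b) n) (RInt F a b)) < e).
  rewrite <- (is_RInt_unique _ _ _ _ (Hsum n)).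
  rewrite <- (RInt_minus (V := R_CompleteNormedModule)) by (exact HF || (eexists; apply Hsum)).
  apply Rle_lt_trans with ((b - a) * (e / (b - a + 1))).
  - apply abs_RInt_le_const; [easy| |].
    + apply (ex_RInt_minus (V := R_NormedModule)); [eexists; apply Hsum|exact HF].
    + intros x Hx. eapply Rle_trans; [now apply Htail|]. lra.
  - replace (pos e) with ((b - a + 1) * (e / (b - a + 1))) at 2 by (field; lra).
    apply Rmult_lt_compat_r; lra.
Qed.

Lemma ex_RInt_of_derivable (f : R -> R) a b : (forall x, ex_derive f x) -> ex_RInt f a b.
Proof.
  intros Hf. apply (@ex_RInt_continuous R_CompleteNormedModule).
  intros x _. apply (@ex_derive_continuous R_AbsRing R_NormedModule), Hf.
Qed.

Lemma RInt_of_derivative (f df : R -> R) a b :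
  a <= b ->
  (forall x, a <= x <= b -> is_derive f x (df x)) ->
  (forall x, ex_derive df x) ->
  RInt df a b = f b - f a.
Proof.
  intros Hab Hf Hdf. apply is_RInt_unique.
  apply (is_RInt_derive (V := R_CompleteNormedModule)); intros x Hx.
  - rewrite Rmin_left, Rmax_right in Hx by easy. now apply Hf.
  - apply (@ex_derive_continuous R_AbsRing R_NormedModule), Hdf.
Qed.

Lemma RInt_congr (f g : R -> R) a b : (forall x, f x = g x) -> RInt f a b = RInt g a b.
Proof. intros H. apply RInt_ext. intros x _. apply H. Qed.

Lemma RInt_linear (f g : R -> R) a b c d :
  (forall x, ex_derive f x) -> (forall x, ex_derive g x) ->
  RInt (fun x => c * f x + d * g x) a b = c * RInt f a b + d * RInt g a b.
Proof.
  intros Hf Hg. apply is_RInt_unique.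
  apply (is_RInt_plus (V := R_NormedModule) (fun x => c * f x) (fun x => d * g x)).
  - apply (is_RInt_scal (V := R_NormedModule) f a b c).
    apply (@RInt_correct R_CompleteNormedModule). now apply ex_RInt_of_derivable.
  - apply (is_RInt_scal (V := R_NormedModule) g a b d).
    apply (@RInt_correct R_CompleteNormedModule). now apply ex_RInt_of_derivable.
Qed.

(** * The binomial series of 1 / sqrt (1 - x) *)

Definition inv_sqrt_coeff (n : nat) : R := pochhammer (1 / 2) n / INR (fact n).

Lemma inv_sqrt_coeff_S n :
  INR (S n) * inv_sqrt_coeff (S n) = (INR n + 1 / 2) * inv_sqrt_coeff n.
Proof.
  unfold inv_sqrt_coeff. rewrite fact_simpl, mult_INR. simpl pochhammer.
  pose proof (INR_fact_neq_0 n). pose proof (pos_INR n).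
  rewrite S_INR. field. lra.
Qed.

Lemma inv_sqrt_coeff_bounds n : 0 <= inv_sqrt_coeff n <= 1.
Proof.
  induction n as [|n IH].
  - unfold inv_sqrt_coeff. simpl. lra.
  - pose proof (inv_sqrt_coeff_S n) as H. rewrite S_INR in H.
    pose proof (pos_INR n). split; nra.
Qed.

(** The coefficients are bounded, hence the radius of convergence is at least 1. *)
Lemma CV_radius_inv_sqrt_coeff x :
  Rabs x < 1 -> Rbar_lt (Rabs x) (CV_radius inv_sqrt_coeff).
Proof.
  intros Hx. apply Rbar_lt_le_trans with 1; [exact Hx|].
  apply (CV_radius_bounded inv_sqrt_coeff). exists 1. intros n.
  rewrite pow1, Rmult_1_r.
  pose proof (inv_sqrt_coeff_bounds n). apply Rabs_le. lra.
Qed.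

(** This is the recurrence [inv_sqrt_coeff_S] read on generating functions. *)
Lemma PSeries_inv_sqrt_coeff_ode x :
  Rabs x < 1 ->
  (1 - x) * PSeries (PS_derive inv_sqrt_coeff) x = PSeries inv_sqrt_coeff x / 2.
Proof.
  intros Hx.
  pose proof (CV_radius_inv_sqrt_coeff x Hx) as Hr.
  assert (Hd : ex_pseries (PS_derive inv_sqrt_coeff) x).
  { apply CV_radius_inside. now rewrite CV_radius_derive. }
  assert (H : PSeries (PS_derive inv_sqrt_coeff) x =
              x * PSeries (PS_derive inv_sqrt_coeff) x + 1 / 2 * PSeries inv_sqrt_coeff x).
  { rewrite <- PSeries_incr_1, <- PSeries_scal, <- PSeries_plus.
    - apply PSeries_ext. intros [|n]; unfold PS_plus, PS_scal, PS_incr_1, PS_derive.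
      + rewrite inv_sqrt_coeff_S. unfold plus, scal, zero; simpl; unfold mult; simpl. ring.
      + rewrite inv_sqrt_coeff_S. unfold plus, scal; simpl plus; unfold mult; simpl mult.
        change ((INR (S n) + 1 / 2) * inv_sqrt_coeff (S n) =
          INR (S n) * inv_sqrt_coeff (S n) + 1 / 2 * inv_sqrt_coeff (S n)). ring.
    - now apply ex_pseries_incr_1.
    - apply ex_pseries_scal; [apply Rmult_comm|now apply CV_radius_inside]. }
  lra.
Qed.

(** The differential equation makes the product of the power series with
    sqrt (1 - x) constant, and at 0 this product is 1. *)
Lemma is_series_inv_sqrt x :
  Rabs x < 1 -> is_series (fun n => inv_sqrt_coeff n * x ^ n) (/ sqrt (1 - x)).
Proof.
  intros Hx.
  set (F := fun z => PSeries inv_sqrt_coeff z * sqrt (1 - z)).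
  assert (HF : forall z, Rabs z < 1 -> is_derive F z 0).
  { intros z Hz. pose proof (Rabs_def2 _ _ Hz) as Hz'.
    assert (Hs : 0 < sqrt (1 - z)) by (apply sqrt_lt_R0; lra).
    assert (Hs2 : sqrt (1 - z) * sqrt (1 - z) = 1 - z) by (apply sqrt_sqrt; lra).
    pose proof (PSeries_inv_sqrt_coeff_ode z Hz) as Hode.
    assert (Hsq : is_derive (fun z => sqrt (1 - z)) z (- 1 / (2 * sqrt (1 - z)))).
    { auto_derive; [lra|]. change (1 + - z) with (1 - z). field. lra. }
    evar_last.
    - apply (is_derive_mult (PSeries inv_sqrt_coeff)).
      + apply is_derive_PSeries. now apply CV_radius_inv_sqrt_coeff.
      + exact Hsq.
      + apply Rmult_comm.
    - unfold plus, mult; simpl.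
      apply Rmult_eq_reg_r with (sqrt (1 - z)); [|lra].
      rewrite Rmult_plus_distr_r, Rmult_assoc, Hs2.
      replace (PSeries inv_sqrt_coeff z * (-1 / (2 * sqrt (1 - z))) * sqrt (1 - z))
        with (- (PSeries inv_sqrt_coeff z / 2)) by (field; lra).
      rewrite <- Hode. ring. }
  assert (HF1 : F x = 1).
  { assert (H0 : F 0 = 1).
    { unfold F. rewrite PSeries_0, Rminus_0_r, sqrt_1.
      unfold inv_sqrt_coeff. simpl. field. }
    apply Rabs_def2 in Hx.
    destruct (Rtotal_order x 0) as [Hlt|[->|Hgt]]; [|exact H0|].
    - rewrite <- H0. apply (eq_is_derive (V := R_NormedModule)); [|lra].
      intros z Hz. apply HF, Rabs_def1; lra.
    - rewrite <- H0. symmetry. apply (eq_is_derive (V := R_NormedModule)); [|lra].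
      intros z Hz. apply HF, Rabs_def1; lra. }
  replace (/ sqrt (1 - x)) with (PSeries inv_sqrt_coeff x).
  - apply (proj1 (is_pseries_R inv_sqrt_coeff x _)). apply PSeries_correct. apply CV_radius_inside.
    exact (CV_radius_inv_sqrt_coeff x Hx).
  - apply Rabs_def2 in Hx.
    assert (Hs : 0 < sqrt (1 - x)) by (apply sqrt_lt_R0; lra).
    unfold F in HF1. apply Rmult_eq_reg_r with (sqrt (1 - x)); [|lra].
    rewrite HF1. field. lra.
Qed.

(** * Wallis integrals *)

Lemma ex_derive_sin_pow n x : ex_derive (fun x => sin x ^ n) x.
Proof. auto_derive. easy. Qed.

(** Integrate the derivative of - cos x sin^(n+1) x, which vanishes at both ends. *)
Lemma RInt_sin_pow_SS n :
  RInt (fun x => sin x ^ S (S n)) 0 (PI / 2)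
  = (INR n + 1) / (INR n + 2) * RInt (fun x => sin x ^ n) 0 (PI / 2).
Proof.
  pose proof (pos_INR n).
  assert (H0 : RInt (fun x => (INR n + 2) * sin x ^ S (S n)
                              + - (INR n + 1) * sin x ^ n) 0 (PI / 2) = 0).
  { rewrite (RInt_of_derivative (fun x => - cos x * sin x ^ S n)).
    - rewrite cos_PI2, sin_0. simpl. ring.
    - pose proof PI_RGT_0. lra.
    - intros x _. auto_derive; [easy|].
      pose proof (sin2_cos2 x) as Hsc. unfold Rsqr in Hsc. simpl.
      replace (match n with 0%nat => 1 | S _ => INR n + 1 end) with (INR n + 1)
        by (destruct n; simpl; ring).
      replace (- cos x * (1 * cos x * ((INR n + 1) * sin x ^ n)))
        with (- (INR n + 1) * (cos x * cos x) * sin x ^ n) by ring.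
      replace (cos x * cos x) with (1 - sin x * sin x) by lra. ring.
    - intros x. auto_derive. easy. }
  rewrite RInt_linear in H0 by (intros; apply ex_derive_sin_pow).
  apply Rmult_eq_reg_l with (INR n + 2); [|lra].
  transitivity ((INR n + 1) * RInt (fun x => sin x ^ n) 0 (PI / 2)); [lra|].
  field. lra.
Qed.

Lemma RInt_sin_pow_4 : RInt (fun x => sin x ^ 4) 0 (PI / 2) = 3 * PI / 16.
Proof.
  rewrite !RInt_sin_pow_SS. simpl.
  rewrite RInt_const. unfold scal; simpl; unfold mult; simpl. field.
Qed.

(** Both sides are multiplied by (5/2 + N)/(3 + N) when N increases by 1; the
    constant 16/(3 pi) is the inverse of the integral of sin^4. *)
Lemma pochhammer_ratio_integral N :
  pochhammer (5 / 2) N / pochhammer 3 N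
  = 16 / (3 * PI) * RInt (fun x => sin x ^ (4 + 2 * N)) 0 (PI / 2).
Proof.
  pose proof PI_RGT_0.
  assert (Hpos : forall n, 0 < pochhammer 3 n).
  { induction n; simpl; [lra|]. apply Rmult_lt_0_compat; [easy|].
    pose proof (pos_INR n). lra. }
  induction N as [|N IH].
  - change (4 + 2 * 0)%nat with 4%nat. rewrite RInt_sin_pow_4. simpl. field. lra.
  - replace (4 + 2 * S N)%nat with (S (S (4 + 2 * N))) by lia.
    rewrite RInt_sin_pow_SS.
    pose proof (pos_INR N). pose proof (Hpos N).
    replace (INR (4 + 2 * N)) with (4 + 2 * INR N)
      by (rewrite plus_INR, mult_INR; simpl; ring).
    simpl pochhammer.
    transitivity (pochhammer (5 / 2) N / pochhammer 3 N * ((5 / 2 + INR N) / (3 + INR N))).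
    + field. lra.
    + rewrite IH. field. lra.
Qed.

Lemma pochhammer_1 n : pochhammer 1 n = INR (fact n).
Proof.
  induction n as [|n IH]; [easy|].
  simpl pochhammer. rewrite IH, fact_simpl, mult_INR, S_INR. ring.
Qed.

(** * The radical and the integral of the Appell function *)

(** The radical of the elliptic integrals of modulus t, in trigonometric form. *)
Definition delta (t x : R) : R := sqrt (1 - t ^ 2 * sin x ^ 2).

Lemma sin_sqr_bounds x : 0 <= sin x ^ 2 <= 1.
Proof. pose proof (SIN_bound x). nra. Qed.

Lemma delta_pos t x : 0 <= t < 1 -> 0 < delta t x.
Proof. intros Ht. apply sqrt_lt_R0. pose proof (sin_sqr_bounds x). nra. Qed.

Lemma delta_sqr t x : 0 <= t < 1 -> delta t x ^ 2 = 1 - t ^ 2 * sin x ^ 2.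
Proof.
  intros Ht. unfold delta. rewrite <- Rsqr_pow2. apply Rsqr_sqrt.
  pose proof (sin_sqr_bounds x). nra.
Qed.

Lemma is_derive_delta t x :
  0 <= t < 1 -> is_derive (delta t) x (- (t ^ 2 * sin x * cos x) / delta t x).
Proof.
  intros Ht. pose proof (delta_pos t x Ht) as Hd. unfold delta in *.
  assert (Hpos : 0 < 1 - t ^ 2 * sin x ^ 2) by (pose proof (sin_sqr_bounds x); nra).
  evar_last.
  - apply (is_derive_sqrt (fun x => 1 - t ^ 2 * sin x ^ 2)); [|exact Hpos].
    auto_derive; [easy|reflexivity].
  - simpl. field. simpl in Hd. lra.
Qed.

Lemma Derive_delta t x :
  0 <= t < 1 -> Derive (fun y : R => delta t y) x = - (t ^ 2 * sin x * cos x) / delta t x.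
Proof. intros Ht. apply is_derive_unique. now apply is_derive_delta. Qed.

Lemma ex_derive_delta t x : 0 <= t < 1 -> ex_derive (delta t) x.
Proof. intros Ht. eexists. now apply is_derive_delta. Qed.

Lemma sin_pow_bounds n x : 0 <= x <= PI / 2 -> 0 <= sin x ^ n <= 1.
Proof.
  intros Hx. pose proof PI_RGT_0.
  assert (0 <= sin x) by (apply sin_ge_0; lra).
  split; [now apply pow_le|].
  rewrite <- (pow1 n). apply pow_incr. pose proof (SIN_bound x). lra.
Qed.

Definition appell_integral (t : R) : R :=
  RInt (fun x => sin x ^ 4 / ((1 - t * sin x ^ 2) * delta t x)) 0 (PI / 2).

Lemma appellF1_term_integral t m n :
  appellF1_term (5 / 2) 1 (1 / 2) 3 t (t ^ 2) m n
  = 16 / (3 * PI) * RInt (fun x => t ^ m * sin x ^ (4 + 2 * m)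
                          * (inv_sqrt_coeff n * (t ^ 2 * sin x ^ 2) ^ n)) 0 (PI / 2).
Proof.
  rewrite (RInt_congr _ (fun x => t ^ m * inv_sqrt_coeff n * (t ^ 2) ^ n
                                  * sin x ^ (4 + 2 * (m + n)) + 0 * 0)).
  - rewrite RInt_linear by (intros; auto_derive; easy).
    transitivity (t ^ m * inv_sqrt_coeff n * (t ^ 2) ^ n
                  * (pochhammer (5 / 2) (m + n) / pochhammer 3 (m + n))).
    + unfold appellF1_term, inv_sqrt_coeff. rewrite pochhammer_1.
      pose proof (INR_fact_neq_0 n). pose proof (INR_fact_neq_0 m).
      assert (pochhammer 3 (m + n) <> 0).
      { apply Rgt_not_eq. generalize (m + n)%nat.
        induction n0; simpl; [lra|]. apply Rmult_lt_0_compat; [easy|].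
        pose proof (pos_INR n0). lra. }
      field. auto.
    + rewrite pochhammer_ratio_integral. ring.
  - intros x.
    replace (4 + 2 * (m + n))%nat with (4 + 2 * m + 2 * n)%nat by lia.
    rewrite (pow_add (sin x) (4 + 2 * m) (2 * n)), Rpow_mult_distr, (pow_mult (sin x) 2 n). ring.
Qed.

(** For fixed m the sum over n is the binomial series of 1 / sqrt (1 - t^2 sin^2 x),
    dominated by the geometric series of ratio t^2. The sum over m that remains is
    the geometric series of 1 / (1 - t sin^2 x), of ratio at most t. *)
Lemma appellF1_integral t :
  0 <= t < 1 ->
  appellF1 (5 / 2) 1 (1 / 2) 3 t (t ^ 2) = 16 / (3 * PI) * appell_integral t.
Proof.
  intros Ht. pose proof PI_RGT_0 as Hpi.
  pose proof sin_sqr_bounds as Hsin.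
  assert (Hinner : forall m,
    is_series (fun n => appellF1_term (5 / 2) 1 (1 / 2) 3 t (t ^ 2) m n)
      (16 / (3 * PI) * RInt (fun x => t ^ m * sin x ^ (4 + 2 * m) * / delta t x) 0 (PI / 2))).
  { intros m.
    apply (is_series_ext (fun n => scal (16 / (3 * PI))
       (RInt (fun x => t ^ m * sin x ^ (4 + 2 * m)
                * (inv_sqrt_coeff n * (t ^ 2 * sin x ^ 2) ^ n)) 0 (PI / 2)))).
    { intros n. symmetry. apply appellF1_term_integral. }
    apply (is_series_scal_l (V := R_NormedModule)).
    apply is_series_RInt_Weierstrass with (M := fun n => (t ^ 2) ^ n).
    - lra.
    - intros n. apply ex_RInt_of_derivable. intros x. auto_derive. easy.
    - apply ex_RInt_of_derivable. intros x. auto_derive.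
      pose proof (delta_pos t x Ht). split; [now apply ex_derive_delta|lra].
    - intros n x Hx.
      pose proof (sin_pow_bounds (4 + 2 * m) x Hx).
      pose proof (inv_sqrt_coeff_bounds n).
      assert (0 <= t ^ m <= 1) by (split; [apply pow_le|rewrite <- (pow1 m); apply pow_incr]; lra).
      assert (0 <= (t ^ 2 * sin x ^ 2) ^ n <= (t ^ 2) ^ n).
      { specialize (Hsin x). split; [apply pow_le|apply pow_incr]; nra. }
      rewrite Rabs_pos_eq.
      + rewrite <- (Rmult_1_l ((t ^ 2) ^ n)). apply Rmult_le_compat.
        * now apply Rmult_le_pos.
        * now apply Rmult_le_pos.
        * apply Rle_trans with (1 * 1); [now apply Rmult_le_compat|lra].
        * rewrite <- (Rmult_1_l ((t ^ 2) ^ n)). now apply Rmult_le_compat.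
      + apply Rmult_le_pos; now apply Rmult_le_pos.
    - apply ex_series_geom. rewrite Rabs_pos_eq; nra.
    - intros x Hx. apply (is_series_scal_l (V := R_NormedModule) (t ^ m * sin x ^ (4 + 2 * m))).
      apply is_series_inv_sqrt. specialize (Hsin x). rewrite Rabs_pos_eq; nra. }
  unfold appellF1.
  apply is_series_unique.
  apply (is_series_ext (fun m => scal (16 / (3 * PI))
     (RInt (fun x => t ^ m * sin x ^ (4 + 2 * m) * / delta t x) 0 (PI / 2)))).
  { intros m. symmetry. apply is_series_unique, Hinner. }
  apply (is_series_scal_l (V := R_NormedModule)).
  assert (HD1 : 0 < sqrt (1 - t ^ 2)) by (apply sqrt_lt_R0; nra).
  apply is_series_RInt_Weierstrass with (M := fun m => scal (/ sqrt (1 - t ^ 2)) (t ^ m)).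
  - lra.
  - intros m. apply ex_RInt_of_derivable. intros x. auto_derive.
    pose proof (delta_pos t x Ht). split; [now apply ex_derive_delta|lra].
  - apply ex_RInt_of_derivable. intros x. auto_derive.
    pose proof (delta_pos t x Ht). specialize (Hsin x).
    split; [now apply ex_derive_delta|]. split; [|easy].
    apply Rgt_not_eq, Rmult_lt_0_compat; nra.
  - intros m x Hx.
    pose proof (sin_pow_bounds (4 + 2 * m) x Hx).
    assert (0 <= t ^ m) by (apply pow_le; lra).
    assert (0 <= / delta t x) by (apply Rlt_le, Rinv_0_lt_compat; now apply delta_pos).
    assert (/ delta t x <= / sqrt (1 - t ^ 2)).
    { apply Rinv_le_contravar; [easy|]. apply sqrt_le_1_alt. specialize (Hsin x). nra. }
    rewrite Rabs_pos_eq.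
    + change (t ^ m * sin x ^ (4 + 2 * m) * / delta t x <= / sqrt (1 - t ^ 2) * t ^ m).
      rewrite (Rmult_comm (/ sqrt (1 - t ^ 2))).
      apply Rmult_le_compat; try easy; [now apply Rmult_le_pos|].
      rewrite <- (Rmult_1_r (t ^ m)) at 2. now apply Rmult_le_compat_l.
    + apply Rmult_le_pos; [now apply Rmult_le_pos|easy].
  - apply (ex_series_scal_l (V := R_NormedModule)), ex_series_geom. rewrite Rabs_pos_eq; lra.
  - intros x Hx. specialize (Hsin x).
    apply (is_series_ext (fun m => scal (sin x ^ 4 / delta t x) ((t * sin x ^ 2) ^ m))).
    + intros m. rewrite pow_add, Rpow_mult_distr, (pow_mult (sin x) 2 m).
      change (sin x ^ 4 / delta t x * (t ^ m * (sin x ^ 2) ^ m)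
              = t ^ m * (sin x ^ 4 * (sin x ^ 2) ^ m) * / delta t x).
      unfold Rdiv. ring.
    + evar_last.
      * apply (is_series_scal_l (V := R_NormedModule)), is_series_geom.
        rewrite Rabs_pos_eq; nra.
      * change (sin x ^ 4 / delta t x * / (1 - t * sin x ^ 2)
                = sin x ^ 4 / ((1 - t * sin x ^ 2) * delta t x)).
        pose proof (delta_pos t x Ht). field. nra.
Qed.

(** * The Gauss transformation of K and E *)

(** Gauss's form of the Landen transformation, precomposed with the sine. *)
Definition gauss_map (t x : R) : R := (1 + t) * sin x / (1 + t * sin x ^ 2).

Definition gauss_map' (t x : R) : R :=
  (1 + t) * cos x * (1 - t * sin x ^ 2) / (1 + t * sin x ^ 2) ^ 2.

Lemma cos_sqr x : cos x ^ 2 = 1 - sin x ^ 2.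
Proof. pose proof (sin2_cos2 x) as H. unfold Rsqr in H. lra. Qed.

Lemma gauss_map_complement t x :
  0 <= t < 1 ->
  1 - gauss_map t x ^ 2 = (cos x * delta t x / (1 + t * sin x ^ 2)) ^ 2.
Proof.
  intros Ht. pose proof (sin_sqr_bounds x).
  unfold Rdiv. rewrite !Rpow_mult_distr, (delta_sqr t x Ht), cos_sqr.
  unfold gauss_map. field. nra.
Qed.

Lemma gauss_map_modulus t k x :
  0 <= t < 1 -> k ^ 2 = 4 * t / (1 + t) ^ 2 ->
  1 - k ^ 2 * gauss_map t x ^ 2 = ((1 - t * sin x ^ 2) / (1 + t * sin x ^ 2)) ^ 2.
Proof.
  intros Ht ->. pose proof (sin_sqr_bounds x).
  unfold gauss_map. field. nra.
Qed.

Lemma is_derive_gauss_map t x :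
  0 <= t < 1 -> is_derive (gauss_map t) x (gauss_map' t x).
Proof.
  intros Ht. pose proof (sin_sqr_bounds x).
  unfold gauss_map, gauss_map'. auto_derive; [nra|].
  field. nra.
Qed.

Lemma RInt_gen_gauss_map (f g : R -> R) t :
  0 <= t < 1 ->
  (forall y, 0 <= y < 1 -> continuous f y) ->
  (forall x, ex_derive g x) ->
  (forall x, 0 <= x < PI / 2 -> gauss_map' t x * f (gauss_map t x) = g x) ->
  RInt_gen f (at_point 0) (at_left 1) = RInt g 0 (PI / 2).
Proof.
  intros Ht Hf Hg Hfg. pose proof PI_RGT_0.
  assert (H0 : gauss_map t 0 = 0) by (unfold gauss_map; rewrite sin_0; field; lra).
  assert (H1 : gauss_map t (PI / 2) = 1) by (unfold gauss_map; rewrite sin_PI2; field; lra).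
  apply is_RInt_gen_unique.
  pose proof (is_RInt_gen_substitution f g (gauss_map t) (gauss_map' t) 0 (PI / 2)) as Hsub.
  rewrite H0, H1 in Hsub. apply Hsub; try easy.
  - lra.
  - intros x _. split; [now apply is_derive_gauss_map|].
    apply (@ex_derive_continuous R_AbsRing R_NormedModule).
    pose proof (sin_sqr_bounds x). unfold gauss_map'. auto_derive. nra.
  - intros x Hx. pose proof (sin_sqr_bounds x).
    assert (0 < cos x) by (apply cos_gt_0; lra).
    apply Rdiv_lt_0_compat; [|nra].
    repeat apply Rmult_lt_0_compat; nra.
  - intros x _. apply (@ex_derive_continuous R_AbsRing R_NormedModule), Hg.
Qed.

Lemma elliptic_factors_pos k y : 0 <= k ^ 2 < 1 -> 0 <= y < 1 ->
  0 < 1 - y ^ 2 /\ 0 < 1 - k ^ 2 * y ^ 2.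
Proof. intros Hk Hy. assert (0 <= y ^ 2 < 1) by nra. nra. Qed.

Lemma gauss_modulus_lt_1 t : 0 <= t < 1 -> 0 <= 4 * t / (1 + t) ^ 2 < 1.
Proof.
  intros Ht. split.
  - apply Rmult_le_pos; [lra|]. apply Rlt_le, Rinv_0_lt_compat. nra.
  - apply Rmult_lt_reg_r with ((1 + t) ^ 2); [nra|].
    unfold Rdiv. rewrite Rmult_assoc, Rinv_l by nra. nra.
Qed.

Lemma ellipticK_gauss t k :
  0 <= t < 1 -> k ^ 2 = 4 * t / (1 + t) ^ 2 ->
  ellipticK k = (1 + t) * RInt (fun x => / delta t x) 0 (PI / 2).
Proof.
  intros Ht Hk. pose proof PI_RGT_0.
  pose proof (gauss_modulus_lt_1 t Ht) as Hk1. rewrite <- Hk in Hk1.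
  assert (Hd : forall x, ex_derive (delta t) x) by (intros; now apply ex_derive_delta).
  assert (Hd0 : forall x, 0 < delta t x) by (intros; now apply delta_pos).
  unfold ellipticK.
  rewrite (RInt_gen_gauss_map _ (fun x => (1 + t) * / delta t x + 0 * 0) t Ht).
  - rewrite RInt_linear; [ring| |]; intros x; auto_derive; [|easy].
    split; [apply Hd|]. specialize (Hd0 x). lra.
  - intros y Hy. destruct (elliptic_factors_pos k y Hk1 Hy).
    assert (Hpos : 0 < (1 - y ^ 2) * (1 - k ^ 2 * y ^ 2)) by (apply Rmult_lt_0_compat; lra).
    apply (@ex_derive_continuous R_AbsRing R_NormedModule). auto_derive.
    split; [exact Hpos|]. split; [|easy]. apply Rgt_not_eq, sqrt_lt_R0. exact Hpos.
  - intros x. auto_derive. specialize (Hd0 x). split; [apply Hd|lra].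
  - intros x Hx. rewrite (gauss_map_modulus t k x Ht Hk), (gauss_map_complement t x Ht).
    assert (0 < cos x) by (apply cos_gt_0; lra).
    specialize (Hd0 x). pose proof (sin_sqr_bounds x).
    rewrite <- Rpow_mult_distr, sqrt_pow2.
    + unfold gauss_map'. field. repeat split; nra.
    + apply Rlt_le, Rmult_lt_0_compat; apply Rdiv_lt_0_compat; nra.
Qed.

(** After the substitution the integrand is rational in sin^2 x, up to the factor
    1/D, with a double pole at 1 + t sin^2 x = 0. Subtracting the derivative of
    2 t sin x cos x D / (1 + t sin^2 x), which integrates to 0, removes the pole. *)
Lemma ellipticE_gauss t k :
  0 <= t < 1 -> k ^ 2 = 4 * t / (1 + t) ^ 2 ->
  (1 + t) * ellipticE k
  = RInt (fun x => 2 * delta t x - (1 - t ^ 2) / delta t x) 0 (PI / 2).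
Proof.
  intros Ht Hk. pose proof PI_RGT_0.
  pose proof (gauss_modulus_lt_1 t Ht) as Hk1. rewrite <- Hk in Hk1.
  set (g := fun x => (1 - t * sin x ^ 2) ^ 2 * (1 + t) / ((1 + t * sin x ^ 2) ^ 2 * delta t x)).
  set (r := fun x => 2 * delta t x - (1 - t ^ 2) / delta t x).
  assert (Hg : forall x, ex_derive g x).
  { intros x. unfold g. pose proof (delta_pos t x Ht). pose proof (sin_sqr_bounds x).
    auto_derive. split; [now apply ex_derive_delta|]. split; [|easy].
    apply Rgt_not_eq. repeat apply Rmult_lt_0_compat; nra. }
  assert (Hr : forall x, ex_derive r x).
  { intros x. unfold r. pose proof (delta_pos t x Ht).
    auto_derive. repeat split; [now apply ex_derive_delta..|lra]. }
  assert (HE : ellipticE k = RInt g 0 (PI / 2)).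
  { unfold ellipticE. rewrite (RInt_gen_gauss_map _ g t Ht); [reflexivity|..].
    - intros y Hy. destruct (elliptic_factors_pos k y Hk1 Hy).
      assert (Hpos : 0 < (1 - k ^ 2 * y ^ 2) / (1 - y ^ 2)) by (now apply Rdiv_lt_0_compat).
      apply (@ex_derive_continuous R_AbsRing R_NormedModule). auto_derive.
      split; [lra|]. split; [exact Hpos|easy].
    - exact Hg.
    - intros x Hx. rewrite (gauss_map_modulus t k x Ht Hk), (gauss_map_complement t x Ht).
      assert (0 < cos x) by (apply cos_gt_0; lra).
      pose proof (delta_pos t x Ht). pose proof (sin_sqr_bounds x).
      unfold Rdiv at 1. rewrite <- pow_inv, <- Rpow_mult_distr, sqrt_pow2.
      + unfold gauss_map', g. field. repeat split; nra.
      + apply Rlt_le, Rmult_lt_0_compat; [apply Rdiv_lt_0_compat; nra|].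
        apply Rinv_0_lt_compat, Rdiv_lt_0_compat; nra. }
  assert (Hdiff : RInt (fun x => (1 + t) * g x + -1 * r x) 0 (PI / 2) = 0).
  { rewrite (RInt_of_derivative
      (fun x => 2 * t * sin x * cos x * delta t x / (1 + t * sin x ^ 2))).
    - rewrite cos_PI2, sin_0, sin_PI2. simpl. field. lra.
    - lra.
    - intros x _. pose proof (delta_pos t x Ht) as Hd. pose proof (sin_sqr_bounds x).
      pose proof (delta_sqr t x Ht) as Hd2. pose proof (cos_sqr x) as Hc2.
      evar_last.
      + auto_derive; [|reflexivity]. split; [now apply ex_derive_delta|]. nra.
      + rewrite (Derive_delta t x Ht).
        unfold g, r. revert Hc2 Hd2 Hd H0.
        generalize (sin x) (cos x) (delta t x). intros s c d Hc2 Hd2 Hd Hs.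
        apply Rmult_eq_reg_r with (d * (1 + t * s ^ 2) ^ 2);
          [|apply Rgt_not_eq; repeat apply Rmult_lt_0_compat; nra].
        transitivity (2 * t * ((c ^ 2 * d ^ 2 - s ^ 2 * d ^ 2 - t ^ 2 * s ^ 2 * c ^ 2)
                               * (1 + t * s ^ 2) - 2 * t * s ^ 2 * c ^ 2 * d ^ 2)).
        * field. split; nra.
        * transitivity ((1 + t) ^ 2 * (1 - t * s ^ 2) ^ 2
                        - (2 * d ^ 2 - (1 - t ^ 2)) * (1 + t * s ^ 2) ^ 2).
          -- rewrite Hc2, Hd2. ring.
          -- field. split; nra.
    - intros x. auto_derive. auto. }
  rewrite RInt_linear in Hdiff by easy. fold r. rewrite HE.
  apply Rminus_diag_uniq. etransitivity; [|exact Hdiff]. ring.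
Qed.

(** * An elementary integral of the third kind *)

(** With u = (1-t) sin x and w = cos x D one has u^2 + w^2 = (1 - t sin^2 x)^2,
    so that (w, u) has a polar angle A, running from 0 to pi/2, and the integrand
    is A' / (1-t). The angle is written with the half-angle formula
    A = 2 atan (u / (1 - t sin^2 x + w)), which, unlike atan (u / w), is
    differentiable up to x = pi/2. *)
Lemma third_kind_integral t :
  0 <= t < 1 ->
  RInt (fun x => (1 + t * sin x ^ 2) / ((1 - t * sin x ^ 2) * delta t x)) 0 (PI / 2)
  = PI / (2 * (1 - t)).
Proof.
  intros Ht. pose proof PI_RGT_0.
  rewrite (RInt_of_derivative (fun x => 2 / (1 - t)
     * atan ((1 - t) * sin x / ((1 - t * sin x ^ 2) + cos x * delta t x)))).
  - rewrite cos_PI2, sin_PI2, sin_0.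
    replace ((1 - t) * 1 / (1 - t * 1 ^ 2 + 0 * delta t (PI / 2))) with 1 by (field; lra).
    replace ((1 - t) * 0 / (1 - t * 0 ^ 2 + cos 0 * delta t 0)) with 0.
    + rewrite atan_1, atan_0. simpl. field. lra.
    + pose proof (delta_pos t 0 Ht). rewrite cos_0. field. lra.
  - lra.
  - intros x Hx. pose proof (delta_pos t x Ht) as Hd. pose proof (sin_sqr_bounds x).
    assert (0 <= cos x) by (apply cos_ge_0; lra).
    pose proof (delta_sqr t x Ht) as Hd2. pose proof (cos_sqr x) as Hc2.
    assert (Hden : 0 < 1 - t * sin x ^ 2 + cos x * delta t x) by nra.
    evar_last.
    + auto_derive; [|reflexivity]. split; [now apply ex_derive_delta|]. split; [|easy].
      apply Rgt_not_eq. exact Hden.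
    + rewrite (Derive_delta t x Ht).
      revert Hc2 Hd2 Hd H0 H1 Hden.
      generalize (sin x) (cos x) (delta t x). intros s c d Hc2 Hd2 Hd Hs Hc.
      set (P := 1 - t * s ^ 2). intros Hden.
      assert (HP : 0 < P) by (unfold P; nra).
      (* The squares of (1 - t) s and c d add up to that of P. *)
      assert (Hpyth : (P + c * d) ^ 2 + ((1 - t) * s) ^ 2 = 2 * (P * (P + c * d))).
      { replace (((1 - t) * s) ^ 2) with (P ^ 2 - c ^ 2 * d ^ 2); [ring|].
        rewrite Hc2, Hd2. unfold P. ring. }
      transitivity (2 * (c * (P + c * d) + 2 * t * s ^ 2 * c + s ^ 2 * d
                         + t ^ 2 * s ^ 2 * c ^ 2 / d)
                    / ((P + c * d) ^ 2 + ((1 - t) * s) ^ 2)).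
      * unfold P in *. field. repeat split; nra.
      * rewrite Hpyth.
        apply Rmult_eq_reg_r with (P * (P + c * d) * d);
          [|apply Rgt_not_eq; repeat apply Rmult_lt_0_compat; lra].
        transitivity (c * d * (P + c * d) + 2 * t * s ^ 2 * c * d
                      + s ^ 2 * d ^ 2 + t ^ 2 * s ^ 2 * c ^ 2); [field; lra|].
        transitivity ((1 + t * s ^ 2) * (P + c * d)); [|field; lra].
        replace (c * d * (P + c * d)) with (c * d * P + c ^ 2 * d ^ 2) by ring.
        rewrite Hc2, Hd2. unfold P. ring.
  - intros x. pose proof (delta_pos t x Ht) as Hd. pose proof (sin_sqr_bounds x).
    auto_derive. split; [now apply ex_derive_delta|]. split; [|easy].
    apply Rgt_not_eq, Rmult_lt_0_compat; nra.
Qed.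

(** * Numerator and denominator *)

Definition numerator_integral (t : R) : R :=
  RInt (fun x => (1 + 2 * t * sin x ^ 2) / delta t x) 0 (PI / 2).

Lemma numerator_integral_pos t : 0 <= t < 1 -> 0 < numerator_integral t.
Proof.
  intros Ht. pose proof PI_RGT_0. apply RInt_gt_0; [lra| |].
  - intros x _. pose proof (delta_pos t x Ht). pose proof (sin_sqr_bounds x).
    apply Rdiv_lt_0_compat; nra.
  - intros x _. apply (@ex_derive_continuous R_AbsRing R_NormedModule).
    pose proof (delta_pos t x Ht). auto_derive. split; [now apply ex_derive_delta|lra].
Qed.

(** The integrands combine because D^2 = 1 - t^2 sin^2 x gives
    (1 + t + t^2) - (2 D^2 - (1 - t^2)) = t (1 + 2 t sin^2 x). *)
Lemma numerator_integral_gauss t k :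
  0 <= t < 1 -> k ^ 2 = 4 * t / (1 + t) ^ 2 ->
  (1 + t + t ^ 2) * ellipticK k - (1 + t) ^ 2 * ellipticE k
  = (1 + t) * (t * numerator_integral t).
Proof.
  intros Ht Hk.
  assert (Hd : forall x, delta t x <> 0).
  { intros x. pose proof (delta_pos t x Ht). lra. }
  assert (Hd' : forall x, ex_derive (delta t) x) by (intros; now apply ex_derive_delta).
  replace ((1 + t) ^ 2 * ellipticE k) with ((1 + t) * ((1 + t) * ellipticE k)) by ring.
  rewrite (ellipticE_gauss t k Ht Hk), (ellipticK_gauss t k Ht Hk).
  unfold numerator_integral.
  replace (RInt (fun x => 2 * delta t x - (1 - t ^ 2) / delta t x) 0 (PI / 2)) with
    (RInt (fun x => (1 + t + t ^ 2) * / delta t x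
                    + - t * ((1 + 2 * t * sin x ^ 2) / delta t x)) 0 (PI / 2)).
  - rewrite RInt_linear by (intros; auto_derive; auto). ring.
  - apply RInt_congr. intros x. specialize (Hd x). pose proof (delta_sqr t x Ht) as Hd2.
    apply Rmult_eq_reg_r with (delta t x); [|easy].
    transitivity (2 * delta t x ^ 2 - (1 - t ^ 2)); [|field; easy].
    rewrite Hd2. field. easy.
Qed.

(** With s = sin x, the numerators satisfy
    4 t^2 s^4 + 2 (1 + 2 t s^2) (1 - t s^2) = 2 (1 + t s^2) over the common
    denominator (1 - t s^2) D. *)
Lemma appell_numerator_relation t :
  0 <= t < 1 ->
  4 * t ^ 2 * appell_integral t + 2 * numerator_integral t = PI / (1 - t).
Proof.
  intros Ht.
  assert (Hd : forall x, 0 < delta t x) by (intros; now apply delta_pos).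
  assert (Hp : forall x, 0 < 1 - t * sin x ^ 2) by (intros; pose proof (sin_sqr_bounds x); nra).
  assert (Hpd : forall x, (1 - t * sin x ^ 2) * delta t x <> 0).
  { intros x. specialize (Hd x). specialize (Hp x). apply Rgt_not_eq, Rmult_lt_0_compat; lra. }
  replace (PI / (1 - t)) with (2 * (PI / (2 * (1 - t)))) by (field; lra).
  rewrite <- third_kind_integral by easy.
  unfold appell_integral, numerator_integral.
  rewrite (RInt_congr (fun x => (1 + t * sin x ^ 2) / ((1 - t * sin x ^ 2) * delta t x))
    (fun x => 2 * t ^ 2 * (sin x ^ 4 / ((1 - t * sin x ^ 2) * delta t x))
              + 1 * ((1 + 2 * t * sin x ^ 2) / delta t x))).
  - rewrite RInt_linear; [ring| |]; intros x; auto_derive;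
      (split; [now apply ex_derive_delta|]).
    + split; [exact (Hpd x)|easy].
    + specialize (Hd x). lra.
  - intros x. specialize (Hd x). specialize (Hp x). field. lra.
Qed.

Theorem theorem5p3 (b : R) (hb : 1 < b) :
  PI =
    8 * b ^ 4 / (1 + b ^ 2) *
    (((b ^ 6 - 1) * ellipticK (2 * b / (1 + b ^ 2))
      + (1 - b ^ 2) * (1 + b ^ 2) ^ 2 * ellipticE (2 * b / (1 + b ^ 2)))
     / (4 * b ^ 6
        + 3 * (1 - b ^ 2)
          * appellF1 (5 / 2) 1 (1 / 2) 3 (1 / b ^ 2) (1 / b ^ 4))).
Proof.
  pose proof PI_RGT_0.
  assert (Hb2 : 1 < b ^ 2) by nra.
  set (t := 1 / b ^ 2).
  assert (Ht : 0 < t < 1).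
  { unfold t. split; [apply Rdiv_lt_0_compat; lra|].
    apply Rmult_lt_reg_r with (b ^ 2); [lra|]. field_simplify; lra. }
  set (k := 2 * b / (1 + b ^ 2)).
  assert (Hk : k ^ 2 = 4 * t / (1 + t) ^ 2) by (unfold k, t; field; nra).
  replace (1 / b ^ 4) with (t ^ 2) by (unfold t; field; lra).
  rewrite appellF1_integral by lra.
  pose proof (numerator_integral_gauss t k ltac:(lra) Hk) as HN.
  pose proof (appell_numerator_relation t ltac:(lra)) as HJ.
  pose proof (numerator_integral_pos t ltac:(lra)) as HV.
  set (V := numerator_integral t) in *.
  replace ((b ^ 6 - 1) * ellipticK k + (1 - b ^ 2) * (1 + b ^ 2) ^ 2 * ellipticE k)
    with ((b ^ 2 - 1) * b ^ 4 * ((1 + t) * (t * V))).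
  2:{ rewrite <- HN. unfold t. field. lra. }
  replace (4 * b ^ 6 + 3 * (1 - b ^ 2) * (16 / (3 * PI) * appell_integral t))
    with (8 * b ^ 4 * (b ^ 2 - 1) * V / PI).
  - unfold t. field. nra.
  - replace (appell_integral t) with ((PI / (1 - t) - 2 * V) / (4 * t ^ 2)).
    + unfold t. field. repeat split; nra.
    + rewrite <- HJ. field. lra.
Qed.
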